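(* Let $(\mathfrak s,\mathfrak s_{-1})$ be a three-dimensional (real) polarised Lie algebra such that $\dim(\mathfrak s_{-1})=2$. Then there is a finite-dimensional Tanaka prolongation $\mathfrak p$ of the Heisenberg Lie algebra $\mathfrak h$ such that $(\mathfrak s,\mathfrak s_{-1})$ is isomorphic to a modification of $\mathfrak h$ in $\mathfrak p$.
   Context: A polarised Lie algebra is a pair $(\mathfrak s,\mathfrak s_{-1})$ of a Lie algebra $\mathfrak s$ and a linear subspace $\mathfrak s_{-1}$ that bracket-generates $\mathfrak s$. Two polarised Lie algebras $(\mathfrak s,\mathfrak s_{-1})$ and $(\mathfrak s',\mathfrak s'_{-1})$ are isomorphic if there is a Lie algebra isomorphism $\phi:\mathfrak s\to\mathfrak s'$ with $\phi(\mathfrak s_{-1})=\mathfrak s'_{-1}$. The Heisenberg Lie algebra $\mathfrak h$ is the three-dimensional real Lie algebra with basis $e_1,e_2,e_3$ and only nontrivial bracket $[e_1,e_2]=e_3$, stratified by $\mathfrak h=\mathfrak g_{-2}\oplus\mathfrak g_{-1}$ with $\mathfrak g_{-1}=\mathrm{span}\{e_1,e_2\}$, $\mathfrak g_{-2}=\mathrm{span}\{e_3\}$. $\mathrm{Der}(\mathfrak h)$ is the Lie algebra of derivations $u$ of $\mathfrak h$ with $u(\mathfrak g_{-1})\subset\mathfrak g_{-1}$. For a Lie subalgebra $\mathfrak g_0\subset\mathrm{Der}(\mathfrak h)$, the Tanaka prolongation $\mathrm{Prol}(\mathfrak h,\mathfrak g_0)=\bigoplus_{k\ge -2}\mathfrak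 g_k$ is the maximal graded Lie algebra containing $\mathfrak h\oplus\mathfrak g_0$ as its non-positive part and such that $u\in\mathfrak g_k$, $k\ge 0$, $[u,\mathfrak g_{-1}]=0$ imply $u=0$; concretely, for $k\ge1$ inductively, $\mathfrak g_k$ is the space of linear maps $u:\mathfrak h\to\bigoplus_{j<k}\mathfrak g_j$ with $u(\mathfrak g_j)\subset\mathfrak g_{j+k}$ ($j=-1,-2$) and $u([X,Y])=[u(X),Y]+[X,u(Y)]$ for $X,Y\in\mathfrak h$. A finite-dimensional Tanaka prolongation of $\mathfrak h$ is a finite-dimensional $\mathfrak p=\mathrm{Prol}(\mathfrak h,\mathfrak g_0)$ for some subalgebra $\mathfrak g_0\subset\mathrm{Der}(\mathfrak h)$; put $\mathfrak q=\bigoplus_{k\ge0}\mathfrak g_k$. A modification of $\mathfrak h$ in $\mathfrak p$ is a polarised Lie algebra $(\mathfrak s,\mathfrak s_{-1})$ where $\mathfrak s\subset\mathfrak p$ is a Lie subalgebra with $\mathfrak p=\mathfrak s\oplus\mathfrak q$ (as vector spaces) and $\mathfrak s_{-1}=(\mathfrak g_{-1}\oplus\mathfrak q)\cap\mathfrak s$. *)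

(* Defs.v *)
From HB Require Import structures.
From mathcomp Require Import all_boot all_order all_algebra.
From mathcomp Require Import ring.

Set Implicit Arguments.
Unset Strict Implicit.
Unset Printing Implicit Defensive.

Import GRing.Theory.
Local Open Scope ring_scope.

Reserved Notation "\[ x , y ]" (at level 0, x, y at level 99,
  format "\[ x ,  y ]").

HB.mixin Record Vector_isLieAlgebra (F : fieldType) L of Vector F L := {
  lieb : L -> L -> L;
  lieb_linearl : forall y, linear (lieb^~ y);
  lieb_linearr : forall x, linear (lieb x);
  liebb : forall x, lieb x x = 0;
  lieb_jacobi : forall x y z,
    lieb x (lieb y z) + lieb y (lieb z x) + lieb z (lieb x y) = 0
}.

#[short(type="lieAlgType")]
HB.structure Definition LieAlgebra (F : fieldType) :=
  {L of Vector F L & Vector_isLieAlgebra F L}.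

Notation "\[ x , y ]" := (lieb x y) : ring_scope.

Section Polarised.
Variables (F : fieldType) (L : lieAlgType F).

Definition lie_subalgebra (S : {vspace L}) : Prop :=
  forall x y, x \in S -> y \in S -> \[x, y] \in S.

(* (S, S1) is a polarised Lie algebra, carried by subspaces of an ambient Lie
   algebra L: the smallest Lie subalgebra containing S1 is S. *)
Definition polarised (S S1 : {vspace L}) : Prop :=
  [/\ lie_subalgebra S, (S1 <= S)%VS
    & forall T : {vspace L}, lie_subalgebra T -> (S1 <= T)%VS -> (S <= T)%VS].

End Polarised.

(* An isomorphism S -> T is represented by a linear map between the ambient
   spaces, of which only the restriction to S matters. *)
Definition polarised_iso (F : fieldType) (L M : lieAlgType F)
    (S S1 : {vspace L}) (T T1 : {vspace M}) : Prop :=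
  exists f : 'Hom(L, M),
    [/\ (lker f :&: S = 0)%VS, (f @: S)%VS = T,
        forall x y, x \in S -> y \in S -> f \[x, y] = \[f x, f y]
      & (f @: S1)%VS = T1].

Section Heisenberg.
Variable F : fieldType.

Definition heis : Type := 'rV[F]_3.
HB.instance Definition _ := Vector.copy heis 'rV[F]_3.

Definition heis_e (i : 'I_3) : heis := delta_mx 0 i.

(* e_1, e_2, e_3 are heis_e 0, heis_e 1 and heis_e 2. *)
Definition heis_bracket (x y : heis) : heis :=
  (x 0 0 * y 0 1 - x 0 1 * y 0 0) *: heis_e 2.

Fact heis_linearl y : linear (heis_bracket^~ y).
Proof.
move=> a u v; rewrite /heis_bracket scalerA -scalerDl !mxE; congr (_ *: _).
by ring.
Qed.

Fact heis_linearr x : linear (heis_bracket x).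
Proof.
move=> a u v; rewrite /heis_bracket scalerA -scalerDl !mxE; congr (_ *: _).
by ring.
Qed.

Fact heis_bracketxx x : heis_bracket x x = 0.
Proof. by rewrite /heis_bracket [x 0 1 * _]mulrC subrr scale0r. Qed.

Fact heis_jacobi x y z :
  heis_bracket x (heis_bracket y z) + heis_bracket y (heis_bracket z x)
    + heis_bracket z (heis_bracket x y) = 0.
Proof.
have h0 u v w : heis_bracket u (heis_bracket v w) = 0.
  by rewrite /heis_bracket /heis_e !mxE /= !mulr0 subrr scale0r.
by rewrite !h0 !addr0.
Qed.

HB.instance Definition _ := Vector_isLieAlgebra.Build F heis
  heis_linearl heis_linearr heis_bracketxx heis_jacobi.

Definition heis_m1 : {vspace heis} := <<[:: heis_e 0%R; heis_e 1%R]>>%VS.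
Definition heis_m2 : {vspace heis} := <[heis_e 2%R]>%VS.

Definition heis_der (u : 'End(heis)) : Prop :=
  (forall X Y, u \[X, Y] = \[u X, Y] + \[X, u Y]) /\
  (u @: heis_m1 <= heis_m1)%VS.

Definition der_subalgebra (g0 : {vspace 'End(heis)}) : Prop :=
  (forall u, u \in g0 -> heis_der u) /\
  (forall u v, u \in g0 -> v \in g0 -> ((u \o v) - (v \o u))%VF \in g0).

End Heisenberg.

(* Gradings by the degrees -2, -1, ..., gr_height. *)
Record lie_grading (F : fieldType) (L : lieAlgType F) := LieGrading {
  gr :> int -> {vspace L};
  gr_height : nat;
  gr_out : forall k : int, k < - 2 \/ gr_height%:Z < k -> gr k = 0%VS;
  gr_direct : directv (\sum_(i < gr_height.+3) gr (i%:Z - 2))%VS;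
  gr_full : (\sum_(i < gr_height.+3) gr (i%:Z - 2))%VS = fullv;
  gr_bracket : forall (i j : int) x y,
    x \in gr i -> y \in gr j -> \[x, y] \in gr (i + j)
}.

Definition gr_nonneg (F : fieldType) (L : lieAlgType F) (G : lie_grading L) :
    {vspace L} :=
  (\sum_(i < (gr_height G).+1) G i%:Z)%VS.

(* p = Prol(heis, g0).  The maps iota and iota0 identify heis (+) g0, with
   [u, X] = u X for u in g0 and X in heis, with the nonpositive part of p; an
   element x of degree k >= 1 is identified with the linear map
   X |-> [x, iota X], which determines x by prol_transitive, and prol_full
   says that every admissible linear map arises in this way. *)
Record is_prolongation (F : fieldType) (g0 : {vspace 'End(heis F)})
    (p : lieAlgType F) (G : lie_grading p)
    (iota : 'Hom(heis F, p)) (iota0 : 'Hom('End(heis F), p)) : Prop := {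
  prol_heis_inj : lker iota = 0%VS;
  prol_heis_bracket : forall X Y, iota \[X, Y] = \[iota X, iota Y];
  prol_m1 : (iota @: heis_m1 F)%VS = G (- 1);
  prol_m2 : (iota @: heis_m2 F)%VS = G (- 2);
  prol_g0_inj : (lker iota0 :&: g0 = 0)%VS;
  prol_g0 : (iota0 @: g0)%VS = G 0;
  prol_g0_heis : forall u X, u \in g0 -> \[iota0 u, iota X] = iota (u X);
  prol_g0_bracket : forall u v, u \in g0 -> v \in g0 ->
    iota0 ((u \o v) - (v \o u))%VF = \[iota0 u, iota0 v];
  prol_transitive : forall (k : nat) x, x \in G k%:Z ->
    (forall y, y \in G (- 1) -> \[x, y] = 0) -> x = 0;
  prol_full : forall (k : nat) (u : 'Hom(heis F, p)), (0 < k)%N ->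
    (u @: heis_m1 F <= G (k%:Z - 1))%VS ->
    (u @: heis_m2 F <= G (k%:Z - 2))%VS ->
    (forall X Y, u \[X, Y] = \[u X, iota Y] + \[iota X, u Y]) ->
    exists2 x, x \in G k%:Z & forall X, u X = \[x, iota X]
}.

Definition tanaka_prolongation (F : fieldType) (g0 : {vspace 'End(heis F)})
    (p : lieAlgType F) (G : lie_grading p) : Prop :=
  der_subalgebra g0 /\
  exists (iota : 'Hom(heis F, p)) (iota0 : 'Hom('End(heis F), p)),
    is_prolongation g0 G iota iota0.

Definition modification (F : fieldType) (p : lieAlgType F) (G : lie_grading p)
    (m m1 : {vspace p}) : Prop :=
  [/\ polarised m m1, (m + gr_nonneg G)%VS = fullv,
      (m :&: gr_nonneg G = 0)%VS & m1 = ((G (- 1) + gr_nonneg G) :&: m)%VS].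

(* Main.v *)
From HB Require Import structures.
Require Import Defs.
From mathcomp Require Import all_boot all_order all_algebra reals.
From mathcomp Require Import ring lra zify.

(* Every three-dimensional contact Lie algebra over the reals embeds in
   p = sl_3 = Prol(heis, diagonal derivations), where e_1 = E_01, e_2 = E_12,
   e_3 = E_02 and q is the space of lower triangular matrices.  Indeed s1 has a
   basis X, Y such that, with Z = [X, Y],
     [X, Z] = b Y + c Z,   [Y, Z] = d X,   c d = 0,
   and then
     X |-> E_01 + b E_10 + (c / 3) diag(2, -1, -1),   Y |-> E_12 - d E_21,
     Z |-> E_02 + b d E_20
   is a morphism of Lie algebras whose image is a complement of q. *)

Set Implicit Arguments.
Unset Strict Implicit.
Unset Printing Implicit Defensive.

Import Order.TTheory GRing.Theory Num.Theory.
Local Open Scope ring_scope.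

(** * Bilinearity and antisymmetry of the Lie bracket *)

Section LieTheory.
Variables (F : fieldType) (L : lieAlgType F).
Implicit Types (x y z : L) (a : F).

Lemma liebDl x y z : \[x + y, z] = \[x, z] + \[y, z].
Proof. by have := lieb_linearl z 1 x y; rewrite !scale1r. Qed.

Lemma liebDr x y z : \[x, y + z] = \[x, y] + \[x, z].
Proof. by have := lieb_linearr x 1 y z; rewrite !scale1r. Qed.

Lemma lieb0 x : \[x, 0] = 0.
Proof. by apply: (addrI \[x, 0]); rewrite -liebDr !addr0. Qed.

Lemma lie0b x : \[0, x] = 0.
Proof. by apply: (addrI \[0, x]); rewrite -liebDl !addr0. Qed.

Lemma liebZl a x y : \[a *: x, y] = a *: \[x, y].
Proof. by have := lieb_linearl y a x 0; rewrite lie0b !addr0. Qed.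

Lemma liebZr a x y : \[x, a *: y] = a *: \[x, y].
Proof. by have := lieb_linearr x a y 0; rewrite lieb0 !addr0. Qed.

Lemma liebC x y : \[x, y] = - \[y, x].
Proof.
apply/eqP; rewrite -addr_eq0; apply/eqP.
by have := liebb (x + y); rewrite liebDl !liebDr !liebb add0r addr0.
Qed.

End LieTheory.

(** * Traceless matrices as a Lie algebra, graded by diagonals *)

Section SpecialLinear.
Variables (F : fieldType) (n : nat).

Definition sl_space : {vspace 'M[F]_n} := lker (linfun (@mxtrace F n : _ -> F^o)).

Lemma mem_sl (A : 'M[F]_n) : (A \in sl_space) = (\tr A == 0).
Proof. by rewrite memv_ker lfunE. Qed.

Definition sl : Type := subvs_of sl_space.
HB.instance Definition _ := Vector.copy sl (subvs_of sl_space).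

Definition slmx : sl -> 'M[F]_n := vsval.
Definition to_sl : 'M[F]_n -> sl := vsproj sl_space.

Fact slmx_is_linear : linear slmx. Proof. by move=> a x y. Qed.
HB.instance Definition _ :=
  GRing.isLinear.Build F sl 'M[F]_n _ slmx slmx_is_linear.

Fact to_sl_is_linear : linear to_sl.
Proof. by move=> a x y; rewrite /to_sl linearP. Qed.
HB.instance Definition _ :=
  GRing.isLinear.Build F 'M[F]_n sl _ to_sl to_sl_is_linear.

Lemma slmx_inj : injective slmx.
Proof. exact: val_inj. Qed.

Lemma slmx_tr x : \tr (slmx x) = 0.
Proof. by apply/eqP; rewrite -mem_sl; apply: subvsP. Qed.

Lemma to_slK (A : 'M[F]_n) : \tr A = 0 -> slmx (to_sl A) = A.
Proof. by move=> trA; rewrite [LHS]vsprojK // mem_sl trA. Qed.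

Lemma slmxP a x y : slmx (a *: x + y) = a *: slmx x + slmx y.
Proof. exact: linearP. Qed.

Lemma slmxD x y : slmx (x + y) = slmx x + slmx y.
Proof. exact: linearD. Qed.

Lemma slmxN x : slmx (- x) = - slmx x.
Proof. exact: linearN. Qed.

Lemma slmx0 : slmx 0 = 0.
Proof. exact: linear0. Qed.

Lemma slmx_eq0 x : (slmx x == 0) = (x == 0).
Proof. by rewrite -slmx0 (inj_eq slmx_inj). Qed.

(** The projection [to_sl] alters nothing here, since a commutator is traceless. *)
Definition sl_bracket (x y : sl) : sl :=
  to_sl (slmx x *m slmx y - slmx y *m slmx x).

Lemma slmx_bracket x y :
  slmx (sl_bracket x y) = slmx x *m slmx y - slmx y *m slmx x.
Proof. by rewrite to_slK // linearB /= mxtrace_mulC subrr. Qed.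

Fact sl_linearl y : linear (sl_bracket^~ y).
Proof.
move=> a u v; apply: slmx_inj.
by rewrite slmxP !slmx_bracket slmxP mulmxDl mulmxDr -scalemxAl -scalemxAr
   scalerBr opprD addrACA.
Qed.

Fact sl_linearr x : linear (sl_bracket x).
Proof.
move=> a u v; apply: slmx_inj.
by rewrite slmxP !slmx_bracket slmxP mulmxDl mulmxDr -scalemxAl -scalemxAr
   scalerBr opprD addrACA.
Qed.

Fact sl_bracketxx x : sl_bracket x x = 0.
Proof. by rewrite /sl_bracket subrr linear0. Qed.

Fact sl_jacobi x y z :
  sl_bracket x (sl_bracket y z) + sl_bracket y (sl_bracket z x)
    + sl_bracket z (sl_bracket x y) = 0.
Proof.
apply: slmx_inj; rewrite !slmxD !slmx_bracket slmx0.
move: (slmx x) (slmx y) (slmx z) => A B C.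
rewrite !mulmxBl !mulmxBr !mulmxA !opprB.
apply/matrixP => i j; rewrite !mxE; ring.
Qed.

HB.instance Definition _ := Vector_isLieAlgebra.Build F sl
  sl_linearl sl_linearr sl_bracketxx sl_jacobi.

Lemma slmxB (x y : sl) : slmx \[x, y] = slmx x *m slmx y - slmx y *m slmx x.
Proof. exact: slmx_bracket. Qed.

(* E_ij has degree i - j, so that the strictly upper triangular matrices have
   negative degree. *)
Definition mx_part (k : int) (A : 'M[F]_n) : 'M[F]_n :=
  \matrix_(i, j) (if i%:Z - j%:Z == k then A i j else 0).

Fact mx_part_is_linear k : linear (mx_part k).
Proof.
move=> a A B; apply/matrixP=> i j; rewrite !mxE; case: ifP => // _.
by rewrite mulr0 addr0.
Qed.
HB.instance Definition _ k :=
  GRing.isLinear.Build F 'M[F]_n 'M[F]_n _ (mx_part k) (mx_part_is_linear k).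

(** The matrices fixed by the projection [mx_part k], written as a kernel so as to be a subspace by
    construction. *)
Definition sl_gr (k : int) : {vspace sl} :=
  lker (linfun (slmx \- (mx_part k \o slmx))).

Lemma sl_grP k x :
  reflect (forall i j : 'I_n, i%:Z - j%:Z != k -> slmx x i j = 0) (x \in sl_gr k).
Proof.
rewrite memv_ker lfunE /= subr_eq0; apply: (iffP eqP) => [-> i j /negPf nk|h].
  by rewrite mxE nk.
by apply/matrixP => i j; rewrite mxE; case: eqP => // /eqP; apply: h.
Qed.

Lemma sl_gr_out (k : int) : k <= - n%:Z \/ n%:Z <= k -> sl_gr k = 0%VS.
Proof.
move=> hk; apply/eqP; rewrite -subv0; apply/subvP => x /sl_grP hx.
rewrite memv0 -slmx_eq0; apply/eqP/matrixP => i j; rewrite mxE hx //.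
have := ltn_ord i; have := ltn_ord j; lia.
Qed.

(** A product [x_im y_mj] can be nonzero only if [i - m = k] and [m - j = l], and then
    [i - j = k + l]; likewise with the factors exchanged. *)
Lemma sl_gr_bracket (k l : int) x y :
  x \in sl_gr k -> y \in sl_gr l -> \[x, y] \in sl_gr (k + l).
Proof.
move=> /sl_grP hx /sl_grP hy; apply/sl_grP => i j nkl.
rewrite slmxB !mxE !big1 ?subrr // => m _.
  case: (eqVneq (i%:Z - m%:Z) l) => [e|/hy->]; last by rewrite mul0r.
  by rewrite [slmx x _ _]hx ?mulr0 //; lia.
case: (eqVneq (i%:Z - m%:Z) k) => [e|/hx->]; last by rewrite mul0r.
by rewrite [slmx y _ _]hy ?mulr0 //; lia.
Qed.

(** The part of degree 0 keeps the whole diagonal, and every other part has zero diagonal. *)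
Lemma mx_part_tr k x : \tr (mx_part k (slmx x)) = 0.
Proof.
case: (eqVneq k 0) => [->|k0].
  by rewrite -[RHS](slmx_tr x); apply: eq_bigr => i _; rewrite mxE subrr eqxx.
by rewrite /mxtrace big1 // => i _; rewrite mxE subrr eq_sym (negPf k0).
Qed.

Lemma sl_part_gr k x : to_sl (mx_part k (slmx x)) \in sl_gr k.
Proof.
by apply/sl_grP => i j /negPf nk; rewrite to_slK ?mx_part_tr // mxE nk.
Qed.

End SpecialLinear.

Lemma ord3_ind (P : 'I_3 -> Prop) : P 0 -> P 1 -> P 2 -> forall i, P i.
Proof.
move=> P0 P1 P2 [[|[|[|//]]] lti].
- by have -> : Ordinal lti = 0 by apply: val_inj.
- by have -> : Ordinal lti = 1 by apply: val_inj.
- by have -> : Ordinal lti = 2 by apply: val_inj.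
Qed.

Lemma sum_ord3 (V : nmodType) (f : 'I_3 -> V) :
  \sum_(i < 3) f i = f 0 + f 1 + f 2.
Proof.
rewrite !big_ord_recl big_ord0 addr0 addrA.
by congr (f _ + f _ + f _); apply: val_inj.
Qed.

(** * The grading of [sl_3] in degrees -2 to 2 *)

Section SL3Grading.
Variable F : fieldType.
Local Notation sl3 := (sl F 3).

Lemma sl3_gr_out (k : int) : k < - 2 \/ 2%:Z < k -> sl_gr F 3 k = 0%VS.
Proof. by move=> hk; apply: sl_gr_out; lia. Qed.

Lemma slmx_sum (I : finType) (f : I -> sl3) :
  slmx (\sum_i f i) = \sum_i slmx (f i).
Proof. exact: linear_sum. Qed.

(** The entry at [(j, l)] can be nonzero in degree [j - l] only, so a vanishing sum vanishes summand
    by summand at each entry. *)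
Lemma sl3_gr_direct : directv (\sum_(i < 5) sl_gr F 3 (i%:Z - 2))%VS.
Proof.
apply/directv_sum_independent => us us_gr us0 i _.
apply/eqP; rewrite -slmx_eq0; apply/eqP/matrixP => j l; rewrite mxE.
case: (eqVneq (j%:Z - l%:Z) (i%:Z - 2)) => [e|ne]; last first.
  by have /sl_grP -> := us_gr i isT.
have := congr1 (fun x => slmx x j l) us0.
rewrite slmx_sum slmx0 summxE mxE (bigD1 i) //= big1 ?addr0 // => m nmi.
have /sl_grP -> // := us_gr m isT.
apply: contra nmi; rewrite e => /eqP h; apply/eqP/val_inj => /=; lia.
Qed.

Lemma sl3_gr_full : (\sum_(i < 5) sl_gr F 3 (i%:Z - 2))%VS = fullv.
Proof.
apply/eqP; rewrite eqEsubv subvf; apply/subvP => x _.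
have -> : x = \sum_(i < 5) to_sl (mx_part (i%:Z - 2) (slmx x)).
  apply: slmx_inj; rewrite slmx_sum; apply/matrixP => j l.
  (* The position of the degree [j - l] after the shift by 2; as [l <= 2], the subtraction is not
     truncated. *)
  have lt5 : (j + 2 - l < 5)%N by have := ltn_ord j; lia.
  rewrite summxE (bigD1 (Ordinal lt5)) //= big1 ?addr0 => [|i ni].
    rewrite to_slK ?mx_part_tr // mxE ifT //; have := ltn_ord l; lia.
  rewrite to_slK ?mx_part_tr // mxE ifF //.
  apply: contraNF ni => /eqP h; apply/eqP/val_inj => /=.
  have := ltn_ord l; lia.
by apply: memv_sumr => i _; apply: sl_part_gr.
Qed.

Definition sl3_grading : lie_grading sl3 :=
  LieGrading sl3_gr_out sl3_gr_direct sl3_gr_full (@sl_gr_bracket F 3).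

Lemma slmxBE (x y : sl3) i j : slmx \[x, y] i j =
  slmx x i 0 * slmx y 0 j + slmx x i 1 * slmx y 1 j + slmx x i 2 * slmx y 2 j
  - (slmx y i 0 * slmx x 0 j + slmx y i 1 * slmx x 1 j
     + slmx y i 2 * slmx x 2 j).
Proof. by rewrite slmxB !mxE !sum_ord3. Qed.

Definition mx3 (a b c d e f g h i : F) : 'M[F]_3 :=
  \matrix_(k, l) (nth [::] [:: [:: a; b; c]; [:: d; e; f]; [:: g; h; i]] k)`_l.

Lemma sl3_eq (x y : sl3) :
  (forall i j, slmx x i j = slmx y i j) -> x = y.
Proof. by move=> h; apply/slmx_inj/matrixP. Qed.

Lemma sl3_tr (x : sl3) : slmx x 0 0 + slmx x 1 1 + slmx x 2 2 = 0.
Proof. by rewrite -[RHS](slmx_tr x) /mxtrace sum_ord3. Qed.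

Lemma slmx_mx3 (a b c d e f g h i : F) : a + e + i = 0 ->
  slmx (to_sl (mx3 a b c d e f g h i)) = mx3 a b c d e f g h i.
Proof. by move=> tr0; rewrite to_slK // /mxtrace sum_ord3 !mxE. Qed.

End SL3Grading.

(** * The Heisenberg algebra as strictly upper triangular matrices *)

Section HeisPart.
Variable F : realFieldType.
Local Notation sl3 := (sl F 3).
Local Notation heis := (heis F).

Definition heis_sl (X : heis) : sl3 :=
  to_sl (mx3 0 (X 0 0) (X 0 2) 0 0 (X 0 1) 0 0 0).

Lemma heis_slE (X : heis) :
  slmx (heis_sl X) = mx3 0 (X 0 0) (X 0 2) 0 0 (X 0 1) 0 0 0.
Proof. by rewrite slmx_mx3 // !addr0. Qed.

Fact heis_sl_is_linear : linear heis_sl.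
Proof.
move=> a X Y; apply: sl3_eq => i j; rewrite slmxP !heis_slE.
by elim/ord3_ind: i; elim/ord3_ind: j; rewrite !mxE /=; ring.
Qed.
HB.instance Definition _ :=
  GRing.isLinear.Build F heis sl3 _ heis_sl heis_sl_is_linear.

(** Among [E_01], [E_12] and [E_02] the only nonzero product is [E_01 E_12 = E_02]. *)
Lemma heis_sl_bracket X Y : heis_sl \[X, Y] = \[heis_sl X, heis_sl Y].
Proof.
apply: sl3_eq => i j; rewrite slmxBE !heis_slE.
elim/ord3_ind: i; elim/ord3_ind: j; rewrite !mxE /= ?mul0r ?mulr0 ?mulr1 //; ring.
Qed.

End HeisPart.

(** * [sl_3] as the Tanaka prolongation of the Heisenberg algebra by its diagonal derivations *)

Section Prolongation.
Variable F : realFieldType.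
Local Notation sl3 := (sl F 3).
Local Notation heis := (heis F).

Lemma heis_eq (X Y : heis) :
  X 0 0 = Y 0 0 -> X 0 1 = Y 0 1 -> X 0 2 = Y 0 2 -> X = Y.
Proof.
by move=> h0 h1 h2; apply/rowP => i; elim/ord3_ind: i.
Qed.

Lemma heis_sum (X : heis) :
  X = X 0 0 *: heis_e F 0 + X 0 1 *: heis_e F 1 + X 0 2 *: heis_e F 2.
Proof. by apply: heis_eq; rewrite !mxE /=; ring. Qed.

Lemma heis_m1P (X : heis) : reflect (X 0 2 = 0) (X \in heis_m1 F).
Proof.
rewrite /heis_m1 span_cons span_seq1; apply: (iffP memv_addP) => [|X2].
  by move=> [_ /vlineP[a ->] [_ /vlineP[b ->] ->]]; rewrite !mxE /=; ring.
exists (X 0 0 *: heis_e F 0); first by rewrite memvZ ?memv_line.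
exists (X 0 1 *: heis_e F 1); first by rewrite memvZ ?memv_line.
by rewrite {1}[X]heis_sum X2 scale0r addr0.
Qed.

Lemma heis_m2P (X : heis) :
  reflect (X 0 0 = 0 /\ X 0 1 = 0) (X \in heis_m2 F).
Proof.
rewrite /heis_m2; apply: (iffP (vlineP _ _)) => [[a ->]|[X0 X1]].
  by rewrite !mxE /= mulr0.
by exists (X 0 2); rewrite {1}[X]heis_sum X0 X1 !scale0r !add0r.
Qed.

(** The weights [a] and [b] on the two generators are free; the derivation rule on their bracket
    forces the weight [a + b]. *)
Definition heis_diag_fun (a b : F) (X : heis) : heis :=
  \row_j [:: a * X 0 0; b * X 0 1; (a + b) * X 0 2]`_j.

Fact heis_diag_is_linear a b : linear (heis_diag_fun a b).
Proof. by move=> c X Y; apply: heis_eq; rewrite !mxE /=; ring. Qed.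
HB.instance Definition _ a b :=
  GRing.isLinear.Build F heis heis _ (heis_diag_fun a b)
    (heis_diag_is_linear a b).

Definition heis_diag (a b : F) : 'End(heis) := linfun (heis_diag_fun a b).

Lemma heis_diagE a b X : heis_diag a b X = heis_diag_fun a b X.
Proof. exact: lfunE. Qed.

Definition diag_der : {vspace 'End(heis)} :=
  (<[heis_diag 1 0]> + <[heis_diag 0 1]>)%VS.

Lemma diag_derP u : reflect (exists a b, u = heis_diag a b) (u \in diag_der).
Proof.
have eq_diag a b : heis_diag a b = a *: heis_diag 1 0 + b *: heis_diag 0 1.
  apply/lfunP => X; rewrite add_lfunE !scale_lfunE !heis_diagE.
  by apply: heis_eq; rewrite !mxE /=; ring.
apply: (iffP memv_addP) => [|[a [b ->]]].
  by move=> [_ /vlineP[a ->] [_ /vlineP[b ->] ->]]; exists a, b;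
    rewrite (eq_diag a b).
exists (a *: heis_diag 1 0); first by rewrite memvZ ?memv_line.
by exists (b *: heis_diag 0 1); rewrite ?memvZ ?memv_line.
Qed.

Lemma heis_diag_comm a b c d :
  ((heis_diag a b \o heis_diag c d) - (heis_diag c d \o heis_diag a b))%VF = 0.
Proof.
apply/lfunP => X; rewrite add_lfunE opp_lfunE !comp_lfunE !heis_diagE zero_lfunE.
by apply: heis_eq; rewrite !mxE /=; ring.
Qed.

Lemma diag_der_subalgebra : der_subalgebra diag_der.
Proof.
split=> [_ /diag_derP[a [b ->]]|]; last first.
  move=> _ _ /diag_derP[a [b ->]] /diag_derP[c [d ->]].
  by rewrite heis_diag_comm mem0v.
split=> [X Y|].
  by rewrite !heis_diagE; apply: heis_eq; rewrite !mxE /=; ring.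
apply/subvP => _ /memv_imgP[X /heis_m1P X2 ->].
by apply/heis_m1P; rewrite heis_diagE mxE /= X2 mulr0.
Qed.

(* The traceless diagonal matrix diag(d0, d1, d2) with d0 - d1 = a and
   d1 - d2 = b acts on the Heisenberg algebra as heis_diag a b. *)
Definition diag_sl (a b : F) : sl3 :=
  to_sl (mx3 ((a *+ 2 + b) / 3) 0 0
             0 ((b - a) / 3) 0
             0 0 (- (a + b *+ 2) / 3)).

Lemma diag_slE a b : slmx (diag_sl a b) =
  mx3 ((a *+ 2 + b) / 3) 0 0 0 ((b - a) / 3) 0 0 0 (- (a + b *+ 2) / 3).
Proof. by rewrite slmx_mx3 //; field. Qed.

(** Reading the two weights off matrix coefficients of [u] gives a linear map on all endomorphisms;
    it is meaningful on [diag_der]. *)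
Definition der_sl_fun (u : 'End(heis)) : sl3 :=
  diag_sl (u (heis_e F 0) 0 0) (u (heis_e F 1) 0 1).

Fact der_sl_is_linear : linear der_sl_fun.
Proof.
move=> a u v; apply: sl3_eq => i j.
rewrite slmxP !diag_slE !add_lfunE !scale_lfunE.
by elim/ord3_ind: i; elim/ord3_ind: j; rewrite !mxE /=; field.
Qed.
HB.instance Definition _ :=
  GRing.isLinear.Build F 'End(heis) sl3 _ der_sl_fun der_sl_is_linear.

Definition iota_heis : 'Hom(heis, sl3) := linfun (@heis_sl F).
Definition iota_der : 'Hom('End(heis), sl3) := linfun der_sl_fun.

Lemma iota_heisE X : iota_heis X = heis_sl X.
Proof. exact: lfunE. Qed.

Lemma iota_derE a b : iota_der (heis_diag a b) = diag_sl a b.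
Proof. by rewrite lfunE /= /der_sl_fun !heis_diagE !mxE /= !mulr1. Qed.

Lemma iota_heis_inj : lker iota_heis = 0%VS.
Proof.
apply/eqP/lker0P => X Y; rewrite !iota_heisE => /(congr1 (@slmx F 3)).
rewrite !heis_slE => /matrixP e.
by apply: heis_eq; [move: (e 0 1)|move: (e 1 2)|move: (e 0 2)]; rewrite !mxE.
Qed.

Lemma iota_heis_m1 : (iota_heis @: heis_m1 F)%VS = sl3_grading F (- 1).
Proof.
apply/vspaceP => x; apply/memv_imgP/sl_grP => [[X /heis_m1P X2 ->] i j|hx].
  rewrite iota_heisE heis_slE.
  by elim/ord3_ind: i; elim/ord3_ind: j; rewrite !mxE.
exists (\row_j [:: slmx x 0 1; slmx x 1 2; 0]`_j).
  by apply/heis_m1P; rewrite mxE.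
rewrite iota_heisE; apply: sl3_eq => i j; rewrite heis_slE.
by elim/ord3_ind: i; elim/ord3_ind: j; rewrite !mxE //= hx.
Qed.

Lemma iota_heis_m2 : (iota_heis @: heis_m2 F)%VS = sl3_grading F (- 2).
Proof.
apply/vspaceP => x; apply/memv_imgP/sl_grP => [[X /heis_m2P[X0 X1] ->] i j|hx].
  rewrite iota_heisE heis_slE.
  by elim/ord3_ind: i; elim/ord3_ind: j; rewrite !mxE.
exists (\row_j [:: 0; 0; slmx x 0 2]`_j).
  by apply/heis_m2P; rewrite !mxE.
rewrite iota_heisE; apply: sl3_eq => i j; rewrite heis_slE.
by elim/ord3_ind: i; elim/ord3_ind: j; rewrite !mxE //= hx.
Qed.

Lemma iota_der_gr0 : (iota_der @: diag_der)%VS = sl3_grading F 0.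
Proof.
apply/vspaceP => x.
apply/memv_imgP/sl_grP => [[_ /diag_derP[a [b ->]] ->] i j|hx].
  rewrite iota_derE diag_slE.
  by elim/ord3_ind: i; elim/ord3_ind: j; rewrite !mxE.
exists (heis_diag (slmx x 0 0 - slmx x 1 1) (slmx x 1 1 - slmx x 2 2)).
  by apply/diag_derP; do 2!eexists.
rewrite iota_derE; apply: sl3_eq => i j; rewrite diag_slE.
(* Tracelessness recovers the diagonal of [x] from its two successive differences. *)
have /eqP := sl3_tr x; rewrite addr_eq0 => /eqP tr0.
have {}tr0 : slmx x 2 2 = - (slmx x 0 0 + slmx x 1 1) by rewrite tr0 opprK.
elim/ord3_ind: i; elim/ord3_ind: j; rewrite !mxE /= ?tr0;
  first [by rewrite hx | by field].
Qed.

Lemma iota_der_inj : (lker iota_der :&: diag_der = 0)%VS.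
Proof.
apply/eqP; rewrite -subv0; apply/subvP => u; rewrite memv_cap memv_ker memv0.
move=> /andP[/[swap] /diag_derP[a [b ->]]].
rewrite iota_derE -slmx_eq0 diag_slE => /eqP/matrixP e.
(* [a] is the difference of the first two diagonal entries, both zero; after that the middle entry
   is [b / 3]. *)
have a0 : a = 0.
  have -> : a = (a *+ 2 + b) / 3 - (b - a) / 3 by field.
  by have := e 0 0; have := e 1 1; rewrite !mxE /= => -> ->; rewrite subrr.
have b0 : b = 0.
  by have := e 1 1; rewrite !mxE /= a0 subr0 => /eqP;
    rewrite mulf_eq0 invr_eq0 pnatr_eq0 orbF => /eqP.
apply/eqP/lfunP => X; rewrite heis_diagE zero_lfunE a0 b0.
by apply: heis_eq; rewrite !mxE /=; ring.
Qed.

Lemma iota_der_heis u X :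
  u \in diag_der -> \[iota_der u, iota_heis X] = iota_heis (u X).
Proof.
move=> /diag_derP[a [b ->]]; rewrite iota_derE !iota_heisE heis_diagE.
apply: sl3_eq => i j; rewrite slmxBE !diag_slE !heis_slE.
by elim/ord3_ind: i; elim/ord3_ind: j; rewrite !mxE /=; field.
Qed.

Lemma iota_der_bracket u v : u \in diag_der -> v \in diag_der ->
  iota_der ((u \o v) - (v \o u))%VF = \[iota_der u, iota_der v].
Proof.
move=> /diag_derP[a [b ->]] /diag_derP[c [d ->]].
rewrite heis_diag_comm linear0 !iota_derE.
apply: sl3_eq => i j; rewrite slmxBE !diag_slE slmx0.
by elim/ord3_ind: i; elim/ord3_ind: j; rewrite !mxE /=; ring.
Qed.

(** Commuting with [E_01] and [E_12] makes the diagonal constant, hence zero by the trace, and kills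
    the entries below it. Those above it vanish because the degree is nonnegative. *)
Lemma sl3_transitive (k : nat) x : x \in sl3_grading F k%:Z ->
  (forall y, y \in sl3_grading F (- 1) -> \[x, y] = 0) -> x = 0.
Proof.
move=> /sl_grP x_gr x_comm.
have comm X : X \in heis_m1 F -> forall i j, slmx \[x, heis_sl X] i j = 0.
  move=> X1 i j; rewrite x_comm ?slmx0 ?mxE //.
  by rewrite -iota_heis_m1 -iota_heisE memv_img.
have m1e0 : heis_e F 0 \in heis_m1 F by apply/heis_m1P; rewrite mxE.
have m1e1 : heis_e F 1 \in heis_m1 F by apply/heis_m1P; rewrite mxE.
have c0 i j := comm _ m1e0 i j.
have c1 i j := comm _ m1e1 i j.
have e1 : slmx x 0 0 = slmx x 1 1.
  have := c0 0 1; rewrite slmxBE heis_slE !mxE /= => h.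
  by apply/eqP; rewrite -subr_eq0 -[X in _ == X]h; apply/eqP; ring.
have e2 : slmx x 1 1 = slmx x 2 2.
  have := c1 1 2; rewrite slmxBE heis_slE !mxE /= => h.
  by apply/eqP; rewrite -subr_eq0 -[X in _ == X]h; apply/eqP; ring.
have x10 : slmx x 1 0 = 0.
  by have := c0 1 1; rewrite slmxBE heis_slE !mxE /= => <-; ring.
have x20 : slmx x 2 0 = 0.
  by have := c0 2 1; rewrite slmxBE heis_slE !mxE /= => <-; ring.
have x21 : slmx x 2 1 = 0.
  by have := c1 2 2; rewrite slmxBE heis_slE !mxE /= => <-; ring.
have x22 : slmx x 2 2 = 0.
  have := sl3_tr x; rewrite e1 e2 -!mulr2n -mulrSr => /eqP.
  by rewrite mulrn_eq0 => /eqP.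
apply: sl3_eq => i j; rewrite slmx0.
by elim/ord3_ind: i; elim/ord3_ind: j; rewrite mxE ?e1 ?e2 ?x22 //; apply: x_gr.
Qed.

Lemma heis_sl_e i j (l : 'I_3) : slmx (heis_sl (heis_e F l)) i j =
  mx3 0 (l == 0)%:R (l == 2)%:R 0 0 (l == 1)%:R 0 0 0 i j.
Proof. by rewrite heis_slE !mxE /= ![_ == l]eq_sym. Qed.

(** [a E_ij] moves column [i] of [a] to column [j], and [E_ij a] moves row [j] to row [i]. This
    table and the next two turn bracket equations into linear equations between entries. *)
Lemma lie_heis_e0 (a : sl3) : slmx \[a, heis_sl (heis_e F 0)] =
  mx3 (- slmx a 1 0) (slmx a 0 0 - slmx a 1 1) (- slmx a 1 2)
      0 (slmx a 1 0) 0
      0 (slmx a 2 0) 0.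
Proof.
apply/matrixP => i j; rewrite slmxBE !heis_sl_e.
by elim/ord3_ind: i; elim/ord3_ind: j; rewrite !mxE /=; ring.
Qed.

Lemma lie_heis_e1 (a : sl3) : slmx \[a, heis_sl (heis_e F 1)] =
  mx3 0 0 (slmx a 0 1)
      (- slmx a 2 0) (- slmx a 2 1) (slmx a 1 1 - slmx a 2 2)
      0 0 (slmx a 2 1).
Proof.
apply/matrixP => i j; rewrite slmxBE !heis_sl_e.
by elim/ord3_ind: i; elim/ord3_ind: j; rewrite !mxE /=; ring.
Qed.

Lemma lie_heis_e2 (a : sl3) : slmx \[a, heis_sl (heis_e F 2)] =
  mx3 (- slmx a 2 0) (- slmx a 2 1) (slmx a 0 0 - slmx a 2 2)
      0 0 (slmx a 1 0)
      0 0 (slmx a 2 0).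
Proof.
apply/matrixP => i j; rewrite slmxBE !heis_sl_e.
by elim/ord3_ind: i; elim/ord3_ind: j; rewrite !mxE /=; ring.
Qed.

(* The entries of x are the only possible ones: [x, e_1] has (1,1)- and
   (2,1)-entries x_10 and x_20, and [x, e_2] has (2,2)-entry x_21. *)
Lemma sl3_degree_determined (k : nat) (a b c : sl3) :
    (0 < k)%N -> a \in sl3_grading F (k%:Z - 1) ->
    b \in sl3_grading F (k%:Z - 1) -> c \in sl3_grading F (k%:Z - 2) ->
    c = \[a, heis_sl (heis_e F 1)] - \[b, heis_sl (heis_e F 0)] ->
    \[a, heis_sl (heis_e F 2)] = \[c, heis_sl (heis_e F 0)] ->
    \[b, heis_sl (heis_e F 2)] = \[c, heis_sl (heis_e F 1)] ->
  exists2 x, x \in sl3_grading F k%:Z &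
    [/\ a = \[x, heis_sl (heis_e F 0)], b = \[x, heis_sl (heis_e F 1)]
      & c = \[x, heis_sl (heis_e F 2)]].
Proof.
move=> k_gt0 /sl_grP ha /sl_grP hb /sl_grP hc.
have ta := sl3_tr a; have tb := sl3_tr b.
move=> /(congr1 (@slmx F 3)); rewrite slmxD slmxN lie_heis_e0 lie_heis_e1.
move=> /matrixP cE.
move=> /(congr1 (@slmx F 3)); rewrite lie_heis_e0 lie_heis_e2 => /matrixP ac.
move=> /(congr1 (@slmx F 3)); rewrite lie_heis_e1 lie_heis_e2 => /matrixP bc.
have v0 : nat_of_ord (0 : 'I_3) = 0%N by [].
have v1 : nat_of_ord (1 : 'I_3) = 1%N by [].
have v2 : nat_of_ord (2 : 'I_3) = 2%N by [].
pose x := to_sl (mx3 0 0 0 (slmx a 1 1) 0 0 (slmx a 2 1) (slmx b 2 2) 0).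
have xE : slmx x = mx3 0 0 0 (slmx a 1 1) 0 0 (slmx a 2 1) (slmx b 2 2) 0.
  by rewrite slmx_mx3 // !addr0.
exists x.
  (* Each nonzero entry of [x] is copied from a position of [a] or [b] of degree one less, so [x]
     inherits degree [k]. *)
  apply/sl_grP => i j nk; rewrite xE.
  move: nk; elim/ord3_ind: i; elim/ord3_ind: j => nk; rewrite !mxE //=;
    [apply: ha | apply: ha | apply: hb]; move: nk; rewrite ?v0 ?v1 ?v2; lia.
(* As [k >= 1], [a] and [b] have degree at least 0 and [c] has degree at least -1. *)
have a01 : slmx a 0 1 = 0 by apply: ha; rewrite v0 v1; lia.
have a02 : slmx a 0 2 = 0 by apply: ha; rewrite v0 v2; lia.
have a12 : slmx a 1 2 = 0 by apply: ha; rewrite v1 v2; lia.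
have b01 : slmx b 0 1 = 0 by apply: hb; rewrite v0 v1; lia.
have b02 : slmx b 0 2 = 0 by apply: hb; rewrite v0 v2; lia.
have b12 : slmx b 1 2 = 0 by apply: hb; rewrite v1 v2; lia.
have c02 : slmx c 0 2 = 0 by apply: hc; rewrite v0 v2; lia.
have := cE 0 0; have := cE 0 1; have := cE 1 0; have := cE 1 1.
have := cE 1 2; have := cE 2 0; have := cE 2 1; have := cE 2 2.
have := ac 0 1; have := ac 0 2; have := ac 1 2; have := ac 2 2.
have := bc 0 1; have := bc 0 2; have := bc 2 1; have := bc 2 2.
move=> {cE ac bc}; rewrite !mxE /=.
move=> b20 _ b00 b21 a20 a10 a00 a21 c22 c21 c20 c12 c11 c10 c01 c00.
(* All relations are linear. In particular they give [2 a_22 = a_00 + a_11] and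
   [2 b_00 = b_11 + b_22], whence [a_22 = b_00 = 0] by the trace. *)
move=> {ha hb hc v0 v1 v2}; split; apply: slmx_inj;
  rewrite (lie_heis_e0, lie_heis_e1, lie_heis_e2) xE {x xE};
  apply/matrixP => i j; elim/ord3_ind: i; elim/ord3_ind: j;
  by rewrite !mxE /=; lra.
Qed.

(** On pairs of basis vectors the derivation rule yields exactly the three equations of
    [sl3_degree_determined]; linearity extends the conclusion to all of [heis]. *)
Lemma sl3_full (k : nat) (u : 'Hom(heis, sl3)) : (0 < k)%N ->
    (u @: heis_m1 F <= sl3_grading F (k%:Z - 1))%VS ->
    (u @: heis_m2 F <= sl3_grading F (k%:Z - 2))%VS ->
    (forall X Y, u \[X, Y] = \[u X, iota_heis Y] + \[iota_heis X, u Y]) ->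
  exists2 x, x \in sl3_grading F k%:Z & forall X, u X = \[x, iota_heis X].
Proof.
move=> k_gt0 /subvP u_m1 /subvP u_m2 u_der.
have e0_m1 : heis_e F 0 \in heis_m1 F by apply/heis_m1P; rewrite mxE.
have e1_m1 : heis_e F 1 \in heis_m1 F by apply/heis_m1P; rewrite mxE.
have e2_m2 : heis_e F 2 \in heis_m2 F by apply: memv_line.
have der i j : u \[heis_e F i, heis_e F j] =
    \[u (heis_e F i), heis_sl (heis_e F j)]
    - \[u (heis_e F j), heis_sl (heis_e F i)].
  by rewrite u_der !iota_heisE [in X in _ + X]liebC.
have e01 : \[heis_e F 0, heis_e F 1] = heis_e F 2.
  by apply: heis_eq; rewrite !mxE /=; ring.
have e02 : \[heis_e F 0, heis_e F 2] = 0.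
  by apply: heis_eq; rewrite !mxE /=; ring.
have e12 : \[heis_e F 1, heis_e F 2] = 0.
  by apply: heis_eq; rewrite !mxE /=; ring.
have [||||||x x_gr [u0 u1 u2]] :=
  @sl3_degree_determined k (u (heis_e F 0)) (u (heis_e F 1)) (u (heis_e F 2))
    k_gt0.
- exact/u_m1/memv_img.
- exact/u_m1/memv_img.
- exact/u_m2/memv_img.
- by rewrite -der e01.
- by apply/eqP; rewrite -subr_eq0 -der e02 linear0.
- by apply/eqP; rewrite -subr_eq0 -der e12 linear0.
exists x => // X; rewrite {1 2}[X]heis_sum !linearD !linearZ /= !iota_heisE.
by rewrite !liebDr !liebZr -u0 -u1 -u2.
Qed.

Theorem sl3_prolongation : tanaka_prolongation diag_der (sl3_grading F).
Proof.
split; first exact: diag_der_subalgebra.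
exists iota_heis, iota_der; split.
- exact: iota_heis_inj.
- by move=> X Y; rewrite !iota_heisE heis_sl_bracket.
- exact: iota_heis_m1.
- exact: iota_heis_m2.
- exact: iota_der_inj.
- exact: iota_der_gr0.
- exact: iota_der_heis.
- exact: iota_der_bracket.
- exact: sl3_transitive.
- exact: sl3_full.
Qed.

End Prolongation.

(* Passing to coordinates turns linear identities between vectors into
   identities of scalars. *)
Import VectorInternalTheory.
Ltac to_coordinates := apply: v2r_inj; apply/rowP => ?;
  rewrite ?(linearD, linearZ, linearN, linear0) /= ?mxE.

(** * Normal frames of three-dimensional contact Lie algebras *)

Section ContactAlgebra.
Variables (F : numFieldType) (s : lieAlgType F) (s1 : {vspace s}).
Hypotheses (dim_s : \dim {:s} = 3%N) (pol_s : polarised {:s}%VS s1).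
Hypothesis (dim_s1 : \dim s1 = 2%N).

Definition lin3 (X Y Z : s) (p q r : F) : s := p *: X + q *: Y + r *: Z.

Lemma memv_span2 (X Y v : s) :
  reflect (exists p q, v = p *: X + q *: Y) (v \in <<[:: X; Y]>>%VS).
Proof.
rewrite span_cons span_seq1; apply: (iffP memv_addP) => [|[p [q ->]]].
  by move=> [_ /vlineP[p ->] [_ /vlineP[q ->] ->]]; exists p, q.
by exists (p *: X); rewrite ?memvZ ?memv_line //; exists (q *: Y);
  rewrite ?memvZ ?memv_line.
Qed.

Lemma span2_change (X Y X' Y' : s) (p q p' q' : F) :
  X' = p *: X + q *: Y -> Y' = p' *: X + q' *: Y -> p * q' - q * p' != 0 ->
  <<[:: X; Y]>>%VS = s1 -> <<[:: X'; Y']>>%VS = s1.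
Proof.
move=> -> -> det0 <-; apply/vspaceP => v.
apply/memv_span2/memv_span2 => [] [a [b ->]].
  by exists (a * p + b * p'), (a * q + b * q'); to_coordinates; ring.
(* Cramer's rule gives the coefficients on the new frame. *)
exists ((a * q' - b * p') / (p * q' - q * p')).
exists ((b * p - a * q) / (p * q' - q * p')).
by to_coordinates; field.
Qed.

(** If [[X, Y]] lay in [s1], then [s1] would be a subalgebra, and bracket generation would make it
    all of [s], against the dimensions. *)
Lemma contact_basis (X Y : s) : <<[:: X; Y]>>%VS = s1 ->
  basis_of {:s} [:: X; Y; \[X, Y]].
Proof.
move=> s1E; have notin : \[X, Y] \notin s1.
  apply/negP => XYs1; have [_ _ gen] := pol_s.
  suff /gen/(_ (subvv _))/dimvS : lie_subalgebra s1 by rewrite dim_s dim_s1.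
  move=> v w; rewrite -{1 2}s1E => /memv_span2[p [q ->]] /memv_span2[p' [q' ->]].
  have -> : \[p *: X + q *: Y, p' *: X + q' *: Y] = (p * q' - q * p') *: \[X, Y].
    rewrite !liebDl !liebDr !liebZl !liebZr !liebb [\[Y, X]]liebC.
    by to_coordinates; ring.
  exact: memvZ.
rewrite basisEfree subvf dim_s /= leqnn !andbT.
rewrite -(perm_free (X := [:: \[X, Y]; X; Y])); last first.
  by rewrite -[[:: X; Y; _]]/([:: X; Y] ++ [:: \[X, Y]]) perm_sym perm_catC.
by rewrite free_cons s1E notin /free s1E dim_s1.
Qed.

Section Basis.
Variables X Y Z : s.
Hypothesis basis : basis_of {:s} [:: X; Y; Z].

Lemma basis3_lin3 v : exists p q r, v = lin3 X Y Z p q r.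
Proof.
have := coord_basis (X := [tuple X; Y; Z]) basis (memvf v).
by rewrite sum_ord3 => ->; do 3!eexists.
Qed.

Lemma lin3_inj p q r p' q' r' :
  lin3 X Y Z p q r = lin3 X Y Z p' q' r' -> [/\ p = p', q = q' & r = r'].
Proof.
have lin3E a b c : lin3 X Y Z a b c =
    \sum_(i < 3) [:: a; b; c]`_i *: [tuple X; Y; Z]`_i by rewrite sum_ord3.
rewrite !lin3E => e.
have eqi (i : 'I_3) : [:: p; q; r]`_i = [:: p'; q'; r']`_i.
  by have := congr1 (coord [tuple X; Y; Z] i) e;
    rewrite !coord_sum_free // (basis_free basis).
by split; [apply: (eqi 0) | apply: (eqi 1) | apply: (eqi 2)].
Qed.

End Basis.

Lemma lieb_lin3 (X Y : s) a b c d e f p q p' q' r' :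
  let Z := \[X, Y] in
  \[X, Z] = lin3 X Y Z a b c -> \[Y, Z] = lin3 X Y Z d e f ->
  \[lin3 X Y Z p q 0, lin3 X Y Z p' q' r'] =
    lin3 X Y Z (p * r' * a + q * r' * d) (p * r' * b + q * r' * e)
      (p * q' - q * p' + p * r' * c + q * r' * f).
Proof.
move=> Z XZ YZ; rewrite /lin3 scale0r addr0 !liebDl !liebDr !liebZl !liebZr.
rewrite !liebb [\[Y, X]]liebC -/Z XZ YZ /lin3.
by to_coordinates; ring.
Qed.

(** These are the coordinates of the Jacobi identity for [X, Y, Z]: the one along [Z] gives the
    coefficient [- a], those along [X] and [Y] the two final relations. *)
Lemma contact_structure (X Y : s) : <<[:: X; Y]>>%VS = s1 ->
  let Z := \[X, Y] in
  exists a b c d f, [/\ \[X, Z] = lin3 X Y Z a b c,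
    \[Y, Z] = lin3 X Y Z d (- a) f, f * a = c * d & f * b = - (c * a)].
Proof.
move=> s1E Z; have basis := contact_basis s1E.
have [a [b [c XZ]]] := basis3_lin3 basis \[X, Z].
have [d [e [f YZ]]] := basis3_lin3 basis \[Y, Z].
have lin3X : X = lin3 X Y Z 1 0 0 by rewrite /lin3; to_coordinates; ring.
have lin3Y : Y = lin3 X Y Z 0 1 0 by rewrite /lin3; to_coordinates; ring.
have lin30 : 0 = lin3 X Y Z 0 0 0 by rewrite /lin3; to_coordinates; ring.
have := lieb_jacobi X Y Z.
rewrite [\[Z, X]]liebC -/Z liebb addr0 -scaleN1r liebZr XZ YZ.
have := lieb_lin3 1 0 d e f XZ YZ; rewrite -lin3X => ->.
have := lieb_lin3 0 1 a b c XZ YZ; rewrite -lin3Y => ->.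
have -> p q r p' q' r' : lin3 X Y Z p q r + -1 *: lin3 X Y Z p' q' r' =
    lin3 X Y Z (p - p') (q - q') (r - r').
  by rewrite /lin3; to_coordinates; ring.
rewrite [RHS]lin30 => /(lin3_inj basis)[h1 h2 h3].
have eE : e = - a.
  by apply/eqP; rewrite -addr_eq0 -[X in _ == X]h3; apply/eqP; ring.
exists a, b, c, d, f; rewrite -eE; split=> //; apply/eqP; rewrite -subr_eq0.
  by rewrite -[X in _ == X]h1; apply/eqP; ring.
by rewrite -[X in _ == X]h2 eE; apply/eqP; ring.
Qed.

(** The condition [c * d = 0] is what remains of the Jacobi identity. *)
Definition normal_frame (X Y : s) (b c d : F) := let Z := \[X, Y] in
  [/\ <<[:: X; Y]>>%VS = s1, \[X, Z] = b *: Y + c *: Z, \[Y, Z] = d *: X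
    & c * d = 0].

(* Shearing Y by (a / b) *: X makes ad [X, Y] antidiagonal. *)
Lemma normal_frame_unimodular (X Y : s) a b d : <<[:: X; Y]>>%VS = s1 ->
  let Z := \[X, Y] in
  \[X, Z] = lin3 X Y Z a b 0 -> \[Y, Z] = lin3 X Y Z d (- a) 0 -> b != 0 ->
  exists X Y b c d, normal_frame X Y b c d.
Proof.
move=> s1E Z XZ YZ b0.
have Z' : \[X, (a / b) *: X + Y] = Z.
  by rewrite liebDr liebZr liebb scaler0 add0r.
exists X, ((a / b) *: X + Y), b, 0, (d + a ^+ 2 / b).
rewrite /normal_frame Z'; split; last by rewrite mul0r.
- apply: (@span2_change X Y _ _ 1 0 (a / b) 1) => //.
  + by to_coordinates; ring.
  + by to_coordinates; ring.
  + by rewrite !mul1r mul0r subr0 oner_eq0.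
- by rewrite XZ /lin3; to_coordinates; field.
- by rewrite liebDl liebZl XZ YZ /lin3; to_coordinates; field.
Qed.

(** Modulo [s1], [[X, Z] = c Z] and [[Y, Z] = f Z]. A change of frame makes the second coefficient
    zero. If the first is then nonzero, the Jacobi relations finish; otherwise [ad Z] acts on [s1]
    without trace and has to be made antidiagonal. *)
Lemma exists_normal_frame : exists X Y b c d, normal_frame X Y b c d.
Proof.
have [X [Y s1E]] : exists X Y, <<[:: X; Y]>>%VS = s1.
  have := span_basis (vbasisP s1); case: (vbasis s1) => /= t.
  rewrite dim_s1; case: t => [|X [|Y []]] //= _ s1E; by exists X, Y.
have [a [b [c [d [f [XZ YZ fa fb]]]]]] := contact_structure s1E.
set Z := \[X, Y] in XZ YZ.
have [f0|f0] := eqVneq f 0; last first.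
  (* modulo s1, [v, Z] is a multiple of Z, which vanishes at the second vector
     of this frame *)
  have Z' : \[Y, f *: X - c *: Y] = - f *: Z.
    by rewrite -scaleNr liebDr !liebZr liebb scaler0 addr0 liebC scalerN scaleNr.
  exists Y, (f *: X - c *: Y), (- d), f, 0.
  rewrite /normal_frame Z'; split; last by rewrite mulr0.
  - apply: (@span2_change X Y _ _ 0 1 f (- c)) => //.
    + by to_coordinates; ring.
    + by to_coordinates; ring.
    + by rewrite mul0r mul1r sub0r oppr_eq0.
  - by rewrite liebZr YZ /lin3; to_coordinates; ring: fa.
  - have -> : \[f *: X - c *: Y, - f *: Z] =
        - f *: ((f * a - c * d) *: X + (f * b + c * a) *: Y).
      rewrite liebZr -scaleNr liebDl !liebZl XZ YZ /lin3.
      by to_coordinates; ring.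
    by rewrite fa fb subrr addNr !scale0r addr0 scaler0.
rewrite f0 in YZ fa fb.
have [c0|c0] := eqVneq c 0; last first.
  have d0 : d = 0.
    by apply/eqP; move/eqP: fa; rewrite mul0r eq_sym mulf_eq0 (negPf c0).
  have a0 : a = 0.
    by apply/eqP; move/eqP: fb; rewrite mul0r eq_sym oppr_eq0 mulf_eq0 (negPf c0).
  exists X, Y, b, c, 0; split; rewrite ?mulr0 //.
    by rewrite XZ a0 /lin3 scale0r add0r.
  by rewrite YZ a0 d0 /lin3 oppr0 !scale0r !addr0.
rewrite c0 in XZ.
have [b0|b0] := eqVneq b 0; last exact: normal_frame_unimodular XZ YZ b0.
have [d0|d0] := eqVneq d 0; last first.
  (* The rotated frame [Y, - X] has the same bracket [Z] and puts [- d] in the place of [b]. *)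
  have Z' : \[Y, - X] = Z by rewrite -scaleN1r liebZr scaleN1r -liebC.
  have := @normal_frame_unimodular Y (- X) (- a) (- d) (- b); rewrite Z'.
  apply; rewrite ?oppr_eq0 //.
  - by apply: (@span2_change X Y _ _ 0 1 (-1) 0) => //;
      [to_coordinates; ring | to_coordinates; ring
      | rewrite mulr0 mul1r sub0r opprK oner_eq0].
  - by rewrite YZ /lin3; to_coordinates; ring.
  - by rewrite -scaleN1r liebZl XZ /lin3; to_coordinates; ring.
(* For [a = 0] all brackets with [Z] vanish: this is the Heisenberg algebra. *)
have [a0|a0] := eqVneq a 0.
  exists X, Y, 0, 0, 0; split; rewrite ?mulr0 //.
    by rewrite XZ a0 b0 /lin3 !scale0r !addr0.
  by rewrite YZ a0 d0 /lin3 oppr0 !scale0r !addr0.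
(* Here [ad Z] is diagonal on [s1] with opposite nonzero entries; replacing [X] by [X + Y] creates
   the off-diagonal coefficient [- 2 a]. *)
have Z' : \[X + Y, Y] = Z by rewrite liebDl liebb addr0.
have := @normal_frame_unimodular (X + Y) Y a (- a *+ 2) 0; rewrite Z'; apply.
- by apply: (@span2_change X Y _ _ 1 1 0 1) => //;
    [to_coordinates; ring | to_coordinates; ring
    | rewrite mulr0 mul1r subr0 oner_eq0].
- by rewrite liebDl XZ YZ b0 d0 /lin3; to_coordinates; ring.
- by rewrite YZ d0 /lin3; to_coordinates; ring.
- by rewrite mulrn_eq0 oppr_eq0.
Qed.

End ContactAlgebra.

(** * Images of polarised Lie algebras under morphisms *)

Section Transport.
Variables (F : fieldType) (L M : lieAlgType F) (f : 'Hom(L, M)).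
Hypothesis f_bracket : forall x y, f \[x, y] = \[f x, f y].

(** The preimage of a subalgebra containing the image of [S1] is a subalgebra containing [S1], hence
    contains [S]. *)
Lemma polarised_img (S S1 : {vspace L}) :
  polarised S S1 -> polarised (f @: S)%VS (f @: S1)%VS.
Proof.
move=> [S_sub S1S gen]; split; last first.
- move=> T T_sub fS1T.
  have /gen S_T : lie_subalgebra (f @^-1: T)%VS.
    move=> x y; rewrite -!memv_preim f_bracket; exact: T_sub.
  apply/subvP => _ /memv_imgP[x xS ->]; rewrite memv_preim.
  apply: (subvP (S_T _) _ xS); apply/subvP => y yS1.
  by rewrite -memv_preim (subvP fS1T) ?memv_img.
- exact: limgS.
move=> _ _ /memv_imgP[x xS ->] /memv_imgP[y yS ->].
by rewrite -f_bracket memv_img ?S_sub.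
Qed.

End Transport.

(** * The model of a normal frame inside [sl_3] *)

Section Embedding.
Variable F : realFieldType.
Local Notation sl3 := (sl F 3).
Local Notation G := (sl3_grading F).

Lemma sl3_nonnegP (x : sl3) :
  reflect [/\ slmx x 0 1 = 0, slmx x 1 2 = 0 & slmx x 0 2 = 0]
    (x \in gr_nonneg G).
Proof.
apply: (iffP memv_sumP) => [[xs xs_gr ->]|[x01 x12 x02]].
  by split; rewrite slmx_sum summxE big1 // => k _;
    have /sl_grP -> := xs_gr k isT.
exists (fun i : 'I_3 => to_sl (mx_part i%:Z (slmx x))) => [i _|].
  exact: sl_part_gr.
apply: slmx_inj; rewrite slmx_sum sum_ord3 !to_slK ?mx_part_tr //.
apply/matrixP => i j; elim/ord3_ind: i; elim/ord3_ind: j;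
  by rewrite !mxE /= ?x01 ?x12 ?x02 ?addr0 ?add0r.
Qed.

Lemma sl3_geN1P (x : sl3) :
  reflect (slmx x 0 2 = 0) (x \in (G (- 1) + gr_nonneg G)%VS).
Proof.
apply: (iffP memv_addP) => [[y /sl_grP y1 [z /sl3_nonnegP[_ _ z02] ->]]|x02].
  by rewrite slmxD mxE z02 y1 ?addr0.
exists (to_sl (mx_part (- 1) (slmx x))); first exact: sl_part_gr.
exists (x - to_sl (mx_part (- 1) (slmx x))); last by rewrite addrC subrK.
by apply/sl3_nonnegP; rewrite slmxD slmxN to_slK ?mx_part_tr // !mxE /=
  !subrr x02 subr0.
Qed.

Variables b c d : F.
Hypothesis cd0 : c * d = 0.

(** The image of [p X + q Y + r Z]; its coordinates reappear as the entries above the diagonal. *)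
Definition sl_frame (p q r : F) : sl3 :=
  to_sl (mx3 (p * c *+ 2 / 3) p r
             (p * b) (- (p * c) / 3) q
             (r * (b * d)) (- (q * d)) (- (p * c) / 3)).

Lemma sl_frameE p q r : slmx (sl_frame p q r) =
  mx3 (p * c *+ 2 / 3) p r (p * b) (- (p * c) / 3) q
    (r * (b * d)) (- (q * d)) (- (p * c) / 3).
Proof. by rewrite slmx_mx3 //; field. Qed.

(** The hypothesis [c * d = 0] settles two discrepancies: the [E_20] coefficient of [[X, Z]], which
    is [- b c d] against [b c d], and the diagonal part of [d X], absent from [[Y, Z]]. *)
Lemma sl_frame_bracket p q r p' q' r' :
  \[sl_frame p q r, sl_frame p' q' r'] =
    sl_frame ((q * r' - r * q') * d) ((p * r' - r * p') * b)
      ((p * q' - q * p') + (p * r' - r * p') * c).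
Proof.
apply: sl3_eq => i j; rewrite slmxBE !sl_frameE.
by elim/ord3_ind: i; elim/ord3_ind: j; rewrite !mxE /=; field: cd0.
Qed.

End Embedding.

(** * The embedding attached to a normal frame, and its image as a modification *)

Section NormalFrame.
Variables (F : realFieldType) (s : lieAlgType F) (s1 : {vspace s}).
Hypotheses (dim_s : \dim {:s} = 3%N) (pol_s : polarised {:s}%VS s1).
Hypothesis (dim_s1 : \dim s1 = 2%N).
Variables (X Y : s) (b c d : F).
Hypothesis frame : normal_frame s1 X Y b c d.
Local Notation sl3 := (sl F 3).
Local Notation G := (sl3_grading F).
Local Notation Z := \[X, Y].
Local Notation crd := (coord [tuple X; Y; Z]).

Definition frame_map (v : s) : sl3 :=
  sl_frame b c d (crd 0 v) (crd 1 v) (crd 2 v).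

Fact frame_map_is_linear : linear frame_map.
Proof.
move=> a v w; apply: sl3_eq => i j; rewrite slmxP !sl_frameE !linearP /=.
by elim/ord3_ind: i; elim/ord3_ind: j; rewrite !mxE /=; field.
Qed.
HB.instance Definition _ :=
  GRing.isLinear.Build F s sl3 _ frame_map frame_map_is_linear.

Definition frame_hom : 'Hom(s, sl3) := linfun frame_map.

Let s1E : <<[:: X; Y]>>%VS = s1. Proof. by case: frame. Qed.
Let basis : basis_of {:s} [:: X; Y; Z].
Proof. exact: contact_basis dim_s pol_s dim_s1 _ _ s1E. Qed.

Lemma frame_homE p q r : frame_hom (lin3 X Y Z p q r) = sl_frame b c d p q r.
Proof.
have crdE (i : 'I_3) : crd i (lin3 X Y Z p q r) = [:: p; q; r]`_i.
  have -> : lin3 X Y Z p q r =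
    \sum_(j < 3) [:: p; q; r]`_j *: [tuple X; Y; Z]`_j by rewrite sum_ord3.
  by rewrite coord_sum_free // (basis_free basis).
by rewrite lfunE /= /frame_map !crdE.
Qed.

Lemma frame_hom_bracket v w : frame_hom \[v, w] = \[frame_hom v, frame_hom w].
Proof.
have [_ XZ YZ cd0] := frame.
have [p [q [r ->]]] := basis3_lin3 basis v.
have [p' [q' [r' ->]]] := basis3_lin3 basis w.
(* The bracket in [sl_3] is again the image of an explicit vector, so only a computation in [s] is
   left. *)
rewrite !frame_homE (sl_frame_bracket _ cd0) -frame_homE; congr (frame_hom _).
rewrite /lin3 !(liebDl, liebDr, liebZl, liebZr, liebb).
rewrite [\[Y, X]]liebC [\[Z, X]]liebC [\[Z, Y]]liebC XZ YZ.
by to_coordinates; ring.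
Qed.

Lemma mem_frame_img (x : sl3) :
  reflect (exists p q r, x = sl_frame b c d p q r) (x \in frame_hom @: {:s})%VS.
Proof.
apply: (iffP memv_imgP) => [[v _ ->]|[p [q [r ->]]]].
  have [p [q [r ->]]] := basis3_lin3 basis v.
  by exists p, q, r; rewrite frame_homE.
by exists (lin3 X Y Z p q r); rewrite ?memvf ?frame_homE.
Qed.

(** Degree at least -1 means that the corner entry [r] is zero, which singles out the span of [X]
    and [Y]. *)
Lemma frame_hom_s1 : (frame_hom @: s1)%VS =
  ((G (- 1) + gr_nonneg G) :&: (frame_hom @: {:s}))%VS.
Proof.
apply/vspaceP => x; rewrite memv_cap; apply/memv_imgP/andP => [[v]|[]].
  rewrite -s1E => /memv_span2[p [q ->]] ->.
  have -> : p *: X + q *: Y = lin3 X Y Z p q 0 by rewrite /lin3 scale0r addr0.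
  rewrite frame_homE; split; last by apply/mem_frame_img; do 3!eexists.
  by apply/sl3_geN1P; rewrite sl_frameE mxE.
move=> /sl3_geN1P x02 /mem_frame_img[p [q [r xE]]].
move: x02; rewrite xE sl_frameE mxE /= => r0; exists (p *: X + q *: Y).
  by rewrite -s1E; apply/memv_span2; exists p, q.
by rewrite r0 -frame_homE /lin3 scale0r addr0.
Qed.

Lemma frame_modification :
  modification G (frame_hom @: {:s}) (frame_hom @: s1).
Proof.
split.
- exact: polarised_img frame_hom_bracket _ _ pol_s.
- apply/eqP; rewrite eqEsubv subvf; apply/subvP => x _.
  (* [y] has the same entries above the diagonal as [x], so that [x - y] is lower triangular. *)
  pose y := sl_frame b c d (slmx x 0 1) (slmx x 1 2) (slmx x 0 2).
  apply/memv_addP; exists y; first by apply/mem_frame_img; do 3!eexists.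
  exists (x - y); last by rewrite addrC subrK.
  by apply/sl3_nonnegP; rewrite slmxD slmxN sl_frameE !mxE /= !subrr.
- apply/eqP; rewrite -subv0; apply/subvP => x; rewrite memv_cap memv0.
  move=> /andP[/mem_frame_img[p [q [r ->]]] /sl3_nonnegP].
  rewrite sl_frameE !mxE /= => -[-> -> ->].
  by rewrite -frame_homE /lin3 !scale0r !addr0 linear0.
- exact: frame_hom_s1.
Qed.

Lemma frame_polarised_iso :
  polarised_iso {:s} s1 (frame_hom @: {:s}) (frame_hom @: s1).
Proof.
exists frame_hom; split=> //; last by move=> x y _ _; apply: frame_hom_bracket.
apply/eqP; rewrite -subv0; apply/subvP => v.
rewrite memv_cap memv_ker memv0 memvf andbT.
have [p [q [r ->]]] := basis3_lin3 basis v.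
rewrite frame_homE -slmx_eq0 sl_frameE => /eqP/matrixP e.
have := e 0 1; have := e 1 2; have := e 0 2; rewrite !mxE /= => -> -> ->.
by rewrite /lin3 !scale0r !addr0.
Qed.

End NormalFrame.

Theorem theorem5p1 (R : realType) (s : lieAlgType R) (s1 : {vspace s})
    (dim_s : \dim {:s} = 3%N) (pol_s : polarised {:s}%VS s1)
    (dim_s1 : \dim s1 = 2%N) :
  exists (g0 : {vspace 'End(heis R)}) (p : lieAlgType R) (G : lie_grading p),
    tanaka_prolongation g0 G /\
    exists m m1 : {vspace p},
      modification G m m1 /\ polarised_iso {:s}%VS s1 m m1.
Proof.
have [X [Y [b [c [d frame]]]]] := exists_normal_frame dim_s pol_s dim_s1.
exists (diag_der R), (sl R 3), (sl3_grading R).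
split; first exact: sl3_prolongation.
exists (frame_hom X Y b c d @: {:s})%VS, (frame_hom X Y b c d @: s1)%VS.
split; first exact: frame_modification.
exact: frame_polarised_iso.
Qed.
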